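(* Let $R$ be a unit-regular ring and let $a,b,c\in R$ satisfy $aba=aca$. If $(ac)^{D}$ or $(ba)^{D}$ exists (i.e. at least one of $ac$, $ba$ is Drazin invertible), then $(ac)^{D}\sim (ba)^{D}$. In this case, also $(ac)^2(ac)^D\sim (ba)^2(ba)^D$.
   Context: Rings are associative with identity (not necessarily commutative). A ring $R$ is unit-regular if for every $a\in R$ there is an invertible element $u\in R$ with $aua=a$. An element $a\in R$ is Drazin invertible if there is $x\in R$ with $ax=xa$, $xax=x$ and $a^{k+1}x=a^k$ for some natural number $k$ (equivalently, $ax=xa$, $xax=x$ and $a^2x-a$ is nilpotent); such an $x$ is unique, is called the Drazin inverse of $a$, and is denoted $a^{D}$. An assertion about $(ac)^D$ and $(ba)^D$ in a conclusion includes the assertion that these Drazin inverses exist. Two elements $a,b\in R$ are similar, written $a\sim b$, if $a=s^{-1}bs$ for some invertible $s\in R$. *)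

(* Defs.v *)
From HB Require Import structures.
From mathcomp Require Import all_boot all_order all_algebra.

Set Implicit Arguments.
Unset Strict Implicit.
Unset Printing Implicit Defensive.

Import GRing.Theory.
Local Open Scope ring_scope.

(* The library's predicate GRing.unit needs a unitRingType, which is nontrivial
   and has decidable units; here R is any associative ring with identity. *)
Definition invertible (R : pzRingType) (u : R) : Prop :=
  exists v : R, u * v = 1 /\ v * u = 1.

Definition unit_regular (R : pzRingType) : Prop :=
  forall a : R, exists u : R, invertible u /\ a * u * a = a.

Definition is_drazin (R : pzRingType) (a x : R) : Prop :=
  [/\ a * x = x * a, x * a * x = x & exists k : nat, a ^+ k.+1 * x = a ^+ k].

Definition drazin_invertible (R : pzRingType) (a : R) : Prop :=
  exists x : R, is_drazin a x.

Definition ring_similar (R : pzRingType) (a b : R) : Prop :=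
  exists s t : R, [/\ s * t = 1, t * s = 1 & a = t * b * s].

(* Justifies reading "is_drazin a x" as "x = a^D". *)
Lemma is_drazin_unique (R : pzRingType) (a x y : R) :
  is_drazin a x -> is_drazin a y -> x = y.
Proof.
have pow z n : a * z = z * a -> z * a * z = z -> z ^+ n.+1 * a ^+ n = z.
  move=> cz zaz; elim: n => [|n IHn]; first by rewrite expr0 mulr1 expr1.
  by rewrite exprS (exprSr a) mulrA -(mulrA z) IHn -mulrA -cz mulrA.
have shift z k n : a ^+ k.+1 * z = a ^+ k -> a ^+ (n + k).+1 * z = a ^+ (n + k).
  by move=> E; rewrite -addnS exprD -mulrA E -exprD.
move=> [cx xax [k Ek]] [cy yay [l El]].
have Ex := shift x k l Ek; have := shift y l k El.
rewrite addnC; move: (l + k)%N Ex => n Ex Ey.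
have comm m : y ^+ m * a ^+ n = a ^+ n * y ^+ m.
  by apply: commrX; apply: commr_sym; apply: commrX.
have hx : x = x * a * y.
  by rewrite -{1}(pow x n cx xax) -Ey (exprSr a) !mulrA pow.
rewrite {}hx; rewrite -[RHS](pow y n cy yay) comm -Ex.
have -> : a ^+ n.+1 * x = x * a ^+ n.+1 by apply/esym/commrX/esym.
rewrite (exprS a) -!mulrA -comm.
by rewrite pow.
Qed.

(* Main.v *)
Require Import Defs.
From HB Require Import structures.
From mathcomp Require Import all_boot all_order all_algebra.

Set Implicit Arguments.
Unset Strict Implicit.
Unset Printing Implicit Defensive.

Import GRing.Theory.
Local Open Scope ring_scope.

(* If x = (ac)^D, then (ba)^D = b x^2 a as in Cline's formula.  Multiplication
   by p = (ac)xa, with inverse q = bx, identifies the spectral idempotents acx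
   and bay and carries x to y = (ba)^D.  In a unit-regular ring isomorphic
   idempotents have isomorphic complements, so p extends to an invertible
   element; this element still intertwines x and y, because both vanish on the
   complements. *)

Section Idempotents.
Variable R : pzRingType.
Implicit Types e f p q s t x y : R.

(** Unit-regularity gives a unit [u] with [p * u * p = p], and the complements are then linked by
    the chain 1 - e, 1 - pu, 1 - up, 1 - f: the outer links compare idempotents generating the same
    one-sided ideal, the middle one is conjugation by [u]. *)
Lemma unit_regular_compl_iso e f p q :
    unit_regular R -> p * q = e -> q * p = f -> e * p = p -> p * f = p ->
  exists p' q', [/\ p' * q' = 1 - e, q' * p' = 1 - f,
    (1 - e) * p' = p' /\ p' * (1 - f) = p' &
    (1 - f) * q' = q' /\ q' * (1 - e) = q'].
Proof.
move=> regR pq qp ep pf.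
have [u [[v [uv vu]] pup]] := regR p.
have ee : e * e = e by rewrite -{2}pq mulrA ep.
have ff : f * f = f by rewrite -{1}qp -mulrA pf.
have eC : (1 - e) * (1 - e) = 1 - e.
  by rewrite mulrBr mulr1 mulrBl mul1r ee subrr subr0.
have fC : (1 - f) * (1 - f) = 1 - f.
  by rewrite mulrBr mulr1 mulrBl mul1r ff subrr subr0.
(* The idempotent p u has the same right ideal as e, and u p the same left
   ideal as f, while u conjugates p u to u p. *)
have e_pu : (1 - e) * (1 - p * u) = 1 - e.
  by rewrite mulrBr mulr1 mulrBl mul1r mulrA ep subrr subr0.
have pu_e : (1 - p * u) * (1 - e) = 1 - p * u.
  by rewrite mulrBr mulr1 mulrBl mul1r -{2}pq mulrA pup pq subrr subr0.
have f_up : (1 - f) * (1 - u * p) = 1 - u * p.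
  have fup : f * (u * p) = f by rewrite -qp -mulrA (mulrA p) pup.
  by rewrite mulrBl mul1r mulrBr mulr1 fup subrr subr0.
have up_f : (1 - u * p) * (1 - f) = 1 - f.
  by rewrite mulrBl mul1r mulrBr mulr1 -(mulrA u) pf subrr subr0.
have conj : u * (1 - p * u) = (1 - u * p) * u.
  by rewrite mulrBr mulrBl mulr1 mul1r mulrA.
(* The composites along this chain in the two directions, shortened by the absorption rules
   above. *)
exists ((1 - e) * v * (1 - f)), ((1 - f) * u * (1 - p * u)); split.
- rewrite -!mulrA conj (mulrA (1 - f) (1 - f)) fC (mulrA (1 - f)) f_up -conj.
  by rewrite (mulrA v) vu mul1r e_pu.
- rewrite -!mulrA (mulrA (1 - p * u)) pu_e (mulrA u) conj.
  by rewrite -!mulrA (mulrA u v) uv mul1r up_f fC.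
- by split; rewrite -?mulrA ?fC // !mulrA eC.
- by split; rewrite -?mulrA ?pu_e // !mulrA fC.
Qed.

(** The unit is p + p' with inverse q + q': the cross terms die because [f] meets 1 - f, or [e]
    meets 1 - e, in the middle. *)
Lemma unit_regular_iso_unit e f p q :
    unit_regular R -> p * q = e -> q * p = f ->
    e * p = p -> p * f = p -> f * q = q ->
  exists s t, [/\ s * t = 1, t * s = 1, e * s = p & s * f = p].
Proof.
move=> regR pq qp ep pf fq.
have qe : q * e = q by rewrite -pq mulrA qp.
have ee : e * e = e by rewrite -{2}pq mulrA ep.
have ff : f * f = f by rewrite -{1}qp -mulrA pf.
have eC : e * (1 - e) = 0 by rewrite mulrBr mulr1 ee subrr.
have Ce : (1 - e) * e = 0 by rewrite mulrBl mul1r ee subrr.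
have fC : f * (1 - f) = 0 by rewrite mulrBr mulr1 ff subrr.
have Cf : (1 - f) * f = 0 by rewrite mulrBl mul1r ff subrr.
have [p' [q' [pq' qp' [ep' pf'] [fq' qe']]]] :=
  unit_regular_compl_iso regR pq qp ep pf.
exists (p + p'), (q + q'); split.
- rewrite mulrDl !mulrDr pq pq' -{1}pf -{1}fq' -mulrA (mulrA f) fC mul0r mulr0.
  by rewrite -{1}pf' -{1}fq -mulrA (mulrA (1 - f)) Cf mul0r mulr0
    addr0 add0r addrC subrK.
- rewrite mulrDl !mulrDr qp qp' -{1}qe -{1}ep' -mulrA (mulrA e) eC mul0r mulr0.
  by rewrite -{1}qe' -{1}ep -mulrA (mulrA (1 - e)) Ce mul0r mulr0
    addr0 add0r addrC subrK.
- by rewrite mulrDr ep -ep' mulrA eC mul0r addr0.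
- by rewrite mulrDl pf -pf' -mulrA Cf mulr0 addr0.
Qed.

(** On the corners cut out by [e] and [f] the unit [s] acts as [p], so xs = xes = xp = py = sfy =
    sy. *)
Lemma ring_similar_corner e f p s t x y :
    s * t = 1 -> t * s = 1 -> e * s = p -> s * f = p ->
    x * e = x -> f * y = y -> x * p = p * y -> ring_similar x y.
Proof.
move=> st ts es sf xe fy xp; exists t, s; split=> //.
have xs : x * s = s * y by rewrite -xe -mulrA es xp -sf -mulrA fy.
by rewrite -xs -mulrA st mulr1.
Qed.

End Idempotents.

Section Cline.
Variables (R : pzRingType) (a b c : R).
Hypothesis habc : a * b * a = a * c * a.
Implicit Types x y : R.

(** The hypothesis reads (ac)a = a(ba): [a] intertwines [a * c] and [b * a], hence also their
    powers. *)
Lemma expr_ac_shift n : (a * c) ^+ n * a = a * (b * a) ^+ n.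
Proof.
elim: n => [|n IHn]; first by rewrite !expr0 mul1r mulr1.
by rewrite exprS -mulrA IHn exprS !mulrA habc.
Qed.

Lemma expr_ba n : (b * a) ^+ n.+1 = b * (a * c) ^+ n * a.
Proof. by rewrite exprS -!mulrA -expr_ac_shift. Qed.

Lemma drazin_ac_absorb x : is_drazin (a * c) x -> a * c * x * x = x.
Proof. by move=> [-> + _]. Qed.

(** Since x = a(cxx) starts with a factor [a], the hypothesis trades [b] for [c]. *)
Lemma drazin_ac_swap x : is_drazin (a * c) x -> a * b * x = a * c * x.
Proof.
by move=> /drazin_ac_absorb E; rewrite -[in RHS]E -[in LHS]E !mulrA habc.
Qed.

Lemma drazin_cline_ba x :
  is_drazin (a * c) x -> is_drazin (b * a) (b * x * x * a).
Proof.
move=> dx; have acxx := drazin_ac_absorb dx; have abx := drazin_ac_swap dx.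
have [cx _ [k Ek]] := dx.
have xxac : x * x * (a * c) = x by rewrite -mulrA -cx mulrA -cx acxx.
have abxx : a * b * x * x = x by rewrite abx.
have Ly : b * a * (b * x * x * a) = b * x * a.
  by rewrite -[in RHS]abxx !mulrA.
have Ry : b * x * x * a * (b * a) = b * x * a.
  by rewrite -(mulrA _ a) (mulrA a) habc -[in RHS]xxac !mulrA.
(* The index rises by one because (ba)^(k+1) = b (ac)^k a. *)
split; [by rewrite Ly Ry | | exists k.+1].
- rewrite Ry; transitivity (b * x * (a * b * x * x) * a);
    first by rewrite !mulrA.
  by rewrite abxx.
- rewrite exprSr -mulrA Ly !expr_ba -[in RHS]Ek exprSr.
  transitivity (b * (a * c) ^+ k * (a * b * x) * a); first by rewrite !mulrA.
  by rewrite abx !mulrA.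
Qed.

(** This reduces the case where only [b * a] is known to be Drazin invertible to the other one. *)
Lemma drazin_cline_ac y :
  is_drazin (b * a) y -> is_drazin (a * c) (a * y * y * c).
Proof.
move=> [cy yby [k Ek]].
have bayy : b * a * y * y = y by rewrite cy.
have yyba : y * y * (b * a) = y by rewrite -mulrA -cy mulrA -cy.
(* Here y = yyba ends with a factor [a], so the trade happens on the right of [y]. *)
have yca : y * c * a = y * (b * a).
  rewrite -yyba -!mulrA; congr (y * (y * (b * _))).
  by rewrite !mulrA habc.
have Lx : a * c * (a * y * y * c) = a * y * c.
  by rewrite -[in RHS]bayy !mulrA habc.
have Rx : a * y * y * c * (a * c) = a * y * c.
  transitivity (a * y * (y * c * a) * c); first by rewrite !mulrA.
  by rewrite yca -[in RHS]yyba !mulrA.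
split; [by rewrite Lx Rx | | exists k.+1].
- rewrite Rx; transitivity (a * (y * c * a) * y * y * c);
    first by rewrite !mulrA.
  by rewrite yca -(mulrA a) yby.
- by rewrite exprSr -mulrA Lx !mulrA expr_ac_shift -(mulrA a) Ek
    -expr_ac_shift exprSr mulrA.
Qed.

End Cline.

Theorem theorem2p8 (R : pzRingType) (hR : unit_regular R) (a b c : R)
  (habc : a * b * a = a * c * a)
  (hD : drazin_invertible (a * c) \/ drazin_invertible (b * a)) :
  exists x y : R,
    [/\ is_drazin (a * c) x, is_drazin (b * a) y, ring_similar x y
      & ring_similar ((a * c) ^+ 2 * x) ((b * a) ^+ 2 * y)].
Proof.
have [x dx] : drazin_invertible (a * c).
  by case: hD => // -[y /(drazin_cline_ac habc) dx]; exists (a * y * y * c).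
have dy := drazin_cline_ba habc dx; set y := b * x * x * a in dy.
have [cx xax _] := dx; have [cy yby _] := dy.
have xa : x * a = a * y.
  transitivity (a * b * x * x * a); last by rewrite !mulrA.
  by rewrite (drazin_ac_swap habc dx) (drazin_ac_absorb dx).
have bxac : b * x * (a * c * x) = b * x by rewrite -mulrA (mulrA x) xax.
pose e := a * c * x; pose f := b * a * y; pose p := e * a; pose q := b * x.
have ee : e * e = e by rewrite /e -mulrA (mulrA x) xax.
have ff : f * f = f by rewrite /f -mulrA (mulrA y) yby.
have p_af : p = a * f by rewrite /p /e -mulrA xa !mulrA habc.
have pq : p * q = e.
  transitivity (e * (a * b * x)); first by rewrite !mulrA.
  by rewrite (drazin_ac_swap habc dx).
have qp : q * p = f.
  by rewrite /p /q mulrA bxac /f -[RHS]mulrA -xa !mulrA.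
have ep : e * p = p by rewrite mulrA ee.
have pf : p * f = p by rewrite p_af -mulrA ff.
have fq : f * q = q by rewrite -qp -mulrA pq.
have [s [t [st ts es sf]]] := unit_regular_iso_unit hR pq qp ep pf fq.
have xe : x * e = x by rewrite /e mulrA.
have ye : f * y = y by rewrite /f cy.
have xp : x * p = p * y by rewrite /p mulrA xe xa -/p p_af -mulrA ye.
(* The second similarity uses the same unit: (ac)^2 x = (ac)e and (ba)^2 y = (ba)f lie in the
   corners of [e] and [f], and [p] intertwines [b * a] with [a * c]. *)
have baf : b * a * f = f * (b * a) by rewrite /f -[RHS]mulrA -cy.
have acacx : (a * c) ^+ 2 * x = a * c * e by rewrite expr2 -mulrA.
have babay : (b * a) ^+ 2 * y = b * a * f by rewrite expr2 -mulrA.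
have pba : p * (b * a) = a * c * p.
  by rewrite p_af -mulrA -baf !mulrA habc.
exists x, y; split=> //; first exact: ring_similar_corner st ts es sf xe ye xp.
apply: ring_similar_corner st ts es sf _ _ _; rewrite ?acacx ?babay.
- by rewrite -mulrA ee.
- by rewrite baf mulrA ff.
- by rewrite (mulrA p) pba -(mulrA _ e p) ep -(mulrA _ p f) pf.
Qed.
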